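(* Let $f$ be a proper log-concave function on $\mathbb{R}^d$ such that $\hbar$ is its John function. Then \[ e^{-(d+1)}\,\chi_{\frac{1}{d+1}\mathbf{B}^d}\le f^\circ \] pointwise on $\mathbb{R}^d$.
   Context: A function $\mathbb{R}^d\to[0,\infty)$ is proper log-concave if it is upper semi-continuous, log-concave, with finite positive integral. $\mathbf{B}^d$ is the closed Euclidean unit ball and $\chi_S$ the indicator of $S$. The height function is $\hbar(x)=\sqrt{1-|x|^2}$ on $\mathbf{B}^d$ and $0$ otherwise. Positions of $\hbar$ are functions $\beta\,\hbar(Ax+a)$ with $A$ non-singular, $\beta>0$, $a\in\mathbb{R}^d$; ''$\hbar$ is the John function of $f$'' means $\hbar\le f$ pointwise and $\int g\le\int\hbar$ for every position $g$ of $\hbar$ with $g\le f$. The polar function is $f^\circ(p)=\inf_{\{x:f(x)>0\}}\frac{e^{-\langle p,x\rangle}}{f(x)}$. *)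

(* Defs.v *)
From HB Require Import structures.
From mathcomp Require Import all_boot all_order all_algebra.
From mathcomp Require Import all_classical all_reals all_analysis.
Set Implicit Arguments. Unset Strict Implicit. Unset Printing Implicit Defensive.
Import Order.TTheory GRing.Theory Num.Theory.
Import numFieldNormedType.Exports.
Local Open Scope classical_set_scope.
Local Open Scope ring_scope.

Section Defs.
Variable R : realType.

Definition dotp (d : nat) (p x : 'rV[R]_d) : R := \sum_(i < d) p ord0 i * x ord0 i.
Definition sqnorm (d : nat) (x : 'rV[R]_d) : R := dotp x x.
Definition enorm (d : nat) (x : 'rV[R]_d) : R := Num.sqrt (sqnorm x).

(** Lebesgue integral on R^d, defined as the iterated one-dimensional Lebesgue
    integral over the coordinates (extended-real valued).  For non-negative
    Borel functions this is the d-dimensional Lebesgue integral (Tonelli). *)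
Definition upd_coord (x : nat -> R) (n : nat) (t : R) : nat -> R :=
  fun k => if k == n then t else x k.

Fixpoint iter_int (n : nat) (g : (nat -> R) -> \bar R) (x : nat -> R) : \bar R :=
  match n with
  | 0 => g x
  | n'.+1 => (\int[@lebesgue_measure R]_t iter_int n' g (upd_coord x n' t))%E
  end.

Definition integral_Rd (d : nat) (f : 'rV[R]_d -> R) : \bar R :=
  iter_int d (fun x => (f (\row_(i < d) x (nat_of_ord i)))%:E) (fun _ => 0).

Definition upper_semicontinuous (d : nat) (f : 'rV[R]_d -> R) : Prop :=
  forall c : R, open [set x : 'rV[R]_d | f x < c].

Definition log_concave (d : nat) (f : 'rV[R]_d -> R) : Prop :=
  forall (x y : 'rV[R]_d) (t : R), 0 < t < 1 ->
    f x `^ (1 - t) * f y `^ t <= f ((1 - t) *: x + t *: y).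

Definition proper_log_concave (d : nat) (f : 'rV[R]_d -> R) : Prop :=
  [/\ forall x, 0 <= f x,
      upper_semicontinuous f,
      log_concave f &
      (0 < integral_Rd f < +oo)%E].

Definition hbar (d : nat) (x : 'rV[R]_d) : R :=
  if sqnorm x <= 1 then Num.sqrt (1 - sqnorm x) else 0.

(** Positions of hbar: x |-> beta * hbar(A x + a), A non-singular, beta > 0.
    (Row-vector convention: A x is written x *m A.) *)
Definition is_position (d : nat) (g : 'rV[R]_d -> R) : Prop :=
  exists (A : 'M[R]_d) (beta : R) (a : 'rV[R]_d),
    [/\ A \in unitmx, 0 < beta & forall x, g x = beta * hbar (x *m A + a)].

Definition is_John_function_hbar (d : nat) (f : 'rV[R]_d -> R) : Prop :=
  (forall x, hbar x <= f x) /\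
  (forall g, is_position g -> (forall x, g x <= f x) ->
     (integral_Rd g <= integral_Rd (@hbar d))%E).

Definition polar (d : nat) (f : 'rV[R]_d -> R) (p : 'rV[R]_d) : \bar R :=
  ereal_inf [set ((expR (- dotp p x) / f x)%:E) | x in [set x | 0 < f x]].

Definition chi_ball (d : nat) (r : R) (p : 'rV[R]_d) : R :=
  if enorm p <= r then 1 else 0.

End Defs.

(* Main.v *)
Require Import Defs.
From HB Require Import structures.
From mathcomp Require Import all_boot all_order all_algebra.
From mathcomp Require Import all_classical all_reals all_analysis.
From mathcomp Require Import ring lra.
Import Order.TTheory GRing.Theory Num.Theory.
Local Open Scope ring_scope.

(** Write [L = ln (f x0)] and [r = |x0|].  The bound [L + <p, x0> <= d + 1] for
    [|p| <= 1 / (d + 1)] follows by comparing the John position [hbar] with two families of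
    explicit positions lying below the log-concave hull of [hbar] and [f x0] at [x0].

    Homotheties towards [x0] with ratio [1 - t] and height [exp (t L)] give
    [exp (t L) (1 - t) ^ d <= 1], hence [L <= d] as [t] tends to 0; this suffices when
    [r <= d + 1].  When [r > d + 1], homotheties whose [t] depends affinely on the point of
    the ball glue to a projective map sending the ball onto an ellipsoid stretched towards
    [x0] by [1 + tau (r - 1)] and shrunk by [sqrt (1 - 2 tau)] across; comparing volumes as
    [tau] tends to 0 gives [r - (d + 1) + 2 min (L + 1, 0) <= 0].

    The integral of a position is only needed from below.  By an LQ decomposition and rotation
    invariance of [hbar] the matrix may be taken triangular, and then the iterated integral
    is transformed one variable at a time, without Fubini's theorem. *)

(** * Affine substitution in one-dimensional integrals *)

Section OneDimensional.
Local Open Scope classical_set_scope.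
Local Open Scope ereal_scope.
Context {R : realType}.
Notation mu := (@lebesgue_measure R).
Import HBNNSimple.

Lemma measurable_affine (c b : R) :
  measurable_fun [set: measurableTypeR R]
    ((fun t => c * t + b)%R : measurableTypeR R -> measurableTypeR R).
Proof.
by apply: measurable_realfun.measurable_funD.
Qed.

(** Uniqueness of Lebesgue measure: [c] times the pushforward under the affine map has the right
    value on half-open intervals. *)
Lemma lebesgue_measure_affine (c b : R) (A : set (measurableTypeR R)) :
  (0 < c)%R -> measurable A ->
  mu ((fun t => c * t + b)%R @^-1` A) = c^-1%:E * mu A.
Proof.
move=> c0 mA.
pose T := (fun t => c * t + b)%R : measurableTypeR R -> measurableTypeR R.
have mT : measurable_fun setT T := measurable_affine c b.
pose X : {mfun measurableTypeR R >-> measurableTypeR R} :=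
  HB.pack T (isMeasurableFun.Build _ _ _ _ _ mT).
pose c' := NngNum (ltW c0).
rewrite (_ : mu A = mscale c' (pushforward mu X) A).
  by rewrite /mscale /= muleA -EFinM mulVf ?gt_eqF// mul1e.
apply: lebesgue_measure_unique => // _ [[a e] _ <-] /=.
rewrite /mscale /= /pushforward.
rewrite (_ : _ @^-1` _ = [set` `](a - b) / c, (e - b) / c]]%R); last first.
  apply/seteqP; split=> t; rewrite /= !in_itv /= /T ltr_pdivrMr// ler_pdivlMr//;
  by rewrite ltrBlDr lerBrDr (mulrC t).
rewrite !lebesgue_measure_itv /= !lte_fin ltr_pM2r ?invr_gt0// ltrD2r.
case: ifP => _; last by rewrite mule0.
by rewrite -!EFinD -EFinM; congr EFin; field; rewrite gt_eqF.
Qed.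

Lemma nnsfun_affine (c b : R) (phi : {nnsfun measurableTypeR R >-> R}) :
  (0 < c)%R -> exists2 psi : {nnsfun measurableTypeR R >-> R},
    forall t, psi t = phi (c * t + b)%R &
    sintegral mu psi = c^-1%:E * sintegral mu phi.
Proof.
move=> c0.
pose T := (fun t => c * t + b)%R : measurableTypeR R -> measurableTypeR R.
have mT : measurable_fun setT T := measurable_affine c b.
have mphiT : measurable_fun setT (phi \o T) by exact: measurableT_comp.
have fphiT : finite_set (range (phi \o T)).
  apply: (@sub_finite_set _ _ (range phi)); last exact: fimfunP.
  by move=> _ [t _ <-]; exists (T t).
have phiT0 t : (0 <= (phi \o T) t)%R by exact: fun_ge0.
pose psi : {nnsfun measurableTypeR R >-> R} := HB.pack (phi \o T)
  (isMeasurableFun.Build _ _ _ _ _ mphiT) (FiniteImage.Build _ _ _ fphiT)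
  (isNonNegFun.Build _ _ _ phiT0).
exists psi => //.
rewrite !sintegralET ge0_mule_fsumr; last exact: nnsfun_mulemu_ge0.
apply: eq_fsbigr => x _.
by rewrite [in RHS]muleCA -(lebesgue_measure_affine c b).
Qed.

(* Measurability of [g] and [h] is not assumed: the integral of a nonnegative function is a
   supremum over simple minorants, and this direction only transports minorants. *)
Lemma ge0_le_integral_affine (c b k : R) (g h : R -> \bar R) :
  (0 < c)%R -> (0 < k)%R -> (forall t, 0 <= g t) ->
  (forall t, k%:E * g (c * t + b)%R <= h t) ->
  (k / c)%:E * \int[mu]_t g t <= \int[mu]_t h t.
Proof.
move=> c0 k0 g0 gh.
have h0 t : 0 <= h t by apply: le_trans (gh t); rewrite mule_ge0// lee_fin ltW.
rewrite muleC -lee_pdivlMr ?divr_gt0//.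
rewrite [X in X <= _]ge0_integralTE//; apply: ge_ereal_sup => _ [phi /= phig <-].
rewrite lee_pdivlMr ?divr_gt0//.
have [psi psiE psiI] := nnsfun_affine c b phi c0.
rewrite ge0_integralTE//; apply: ereal_sup_ubound => /=.
exists (scale_nnsfun psi (ltW k0)) => [t|].
  apply: le_trans (gh t); rewrite /= psiE EFinM.
  by rewrite lee_pmul2l// lte_fin.
by rewrite [LHS]sintegralrM ?ltW// psiI [RHS]muleC muleA -EFinM.
Qed.

End OneDimensional.

(** * Iterated integrals over finitely many coordinates *)

Section IteratedIntegral.
Local Open Scope classical_set_scope.
Local Open Scope ereal_scope.
Context {R : realType}.
Implicit Types (g h : (nat -> R) -> \bar R) (x y : nat -> R).

Lemma iter_int_ge0 n g x : (forall x, 0 <= g x) -> 0 <= iter_int n g x.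
Proof.
move=> g0; elim: n x => [|n IHn] x //=.
by apply: integral_ge0 => t _; exact: IHn.
Qed.

(** Integration overwrites each coordinate below [n] before [g] reads it. *)
Lemma eq_iter_int n g x y :
  (forall k, (n <= k)%N -> x k = y k) -> iter_int n g x = iter_int n g y.
Proof.
elim: n x y => [|n IHn] x y xy /=.
  by congr g; apply/funext => k; exact: xy.
apply: eq_integral => t _; apply: IHn => k nk; rewrite /upd_coord.
by case: eqVneq => // kn; apply: xy; rewrite ltn_neqAle eq_sym kn.
Qed.

(* [T] is triangular in the order of integration: when the [j]-th variable is integrated, the
   later coordinates of [T x] are frozen and the [j]-th one is affine in it, so no exchange
   of integrals is needed. *)
Lemma ge0_le_iter_int_triangular n (T : (nat -> R) -> nat -> R) (c : nat -> R)
    (k : R) g h x :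
  (forall j y, (j < n)%N ->
     exists b, forall t, T (upd_coord y j t) j = c j * t + b)%R ->
  (forall j y t i, (j < n)%N -> (j < i)%N -> T (upd_coord y j t) i = T y i) ->
  (forall j, (j < n)%N -> 0 < c j)%R -> (0 < k)%R ->
  (forall x, 0 <= g x) -> (forall x, k%:E * g (T x) <= h x) ->
  (k / \prod_(j < n) c j)%:E * iter_int n g (T x) <= iter_int n h x.
Proof.
move=> Tdiag Tabove c0 k0 g0 gh.
elim: n x Tdiag Tabove c0 => [|n IHn] x Tdiag Tabove c0 /=.
  by rewrite big_ord0 divr1; exact: gh.
have [b Tb] := Tdiag n x (ltnSn n).
have cn0 := c0 n (ltnSn n).
have prod0 : (0 < \prod_(j < n) c j)%R.
  by apply: prodr_gt0 => j _; apply: c0; exact: leqW.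
rewrite big_ord_recr /= invfM mulrA.
apply: (@ge0_le_integral_affine _ _ b _
  (fun t => iter_int n g (upd_coord (T x) n t))) => //.
- by rewrite divr_gt0.
- by move=> t; exact: iter_int_ge0.
move=> t.
rewrite (@eq_iter_int n g _ (T (upd_coord x n t))).
  apply: IHn => [j y jn|j y s i jn ji|j jn].
  - by apply: Tdiag; exact: leqW.
  - by apply: Tabove => //; exact: leqW.
  - by apply: c0; exact: leqW.
move=> i; rewrite leq_eqVlt => /predU1P[<-|ni].
  by rewrite Tb /upd_coord eqxx.
by rewrite Tabove// /upd_coord gtn_eqF.
Qed.

(** Restricting each variable to [-delta, delta] multiplies the lower bound by 2 delta, one
    integration at a time. *)
Lemma iter_int_gt0 n g x (delta c : R) : (0 < delta)%R -> (0 < c)%R ->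
  (forall x, 0 <= g x) ->
  (forall x, (forall i, (i < n)%N -> `|x i| <= delta)%R -> c%:E <= g x) ->
  0 < iter_int n g x.
Proof.
move=> delta0 c0 g0 gc.
suff H m : (m <= n)%N -> exists2 c', (0 < c')%R & forall y,
    (forall i, (m <= i < n)%N -> `|y i| <= delta)%R -> c'%:E <= iter_int m g y.
  have [c' c'0 Hc'] := H n (leqnn n).
  apply: (@lt_le_trans _ _ c'%:E); first by rewrite lte_fin.
  by apply: Hc' => i; rewrite leqNgt andNb.
elim: m => [_|m IHm mn]; first by exists c => // y yi; apply: gc => i ?; exact: yi.
have [c' c'0 Hc'] := IHm (ltnW mn).
exists (c' * (delta + delta))%R; first by rewrite mulr_gt0 ?addr_gt0.
move=> y Hy /=.
pose I : set (measurableTypeR R) := `[(- delta)%R, delta].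
have muI : lebesgue_measure I = (delta + delta)%:E.
  rewrite /I lebesgue_measure_itv /= lte_fin gtrN//.
  by rewrite -EFinD opprK.
apply: le_trans (@ge0_le_integral_affine R 1%R 0%R c'
    (fun t => (\1_I t)%:E) _ ltr01 c'0 _ _) => [|t|t].
- rewrite integral_indic ?setIT//; last exact: measurable_itv.
  by rewrite divr1 EFinM -muI.
- by rewrite lee_fin.
rewrite mul1r addr0 indicE; case: (boolP (t \in I)) => [|_].
  rewrite inE /I /= in_itv /= -ler_norml => tdelta; rewrite mule1.
  apply: Hc' => i /andP[mi im]; rewrite /upd_coord; case: eqVneq => // im'.
  by apply: Hy; rewrite ltn_neqAle eq_sym im' mi.
by rewrite mule0; exact: iter_int_ge0.
Qed.

End IteratedIntegral.

(** * Triangular affine substitution on row vectors *)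

Section IntegralRd.
Local Open Scope ereal_scope.
Context {R : realType}.

(** For [L] lower triangular, coordinate i of [x *m L] involves only x_j with j >= i, so the order
    of integration fits. [T] pads the image with zeros to an infinite sequence. *)
Lemma ge0_le_integral_Rd_triangular d (f g : 'rV[R]_d -> R) (L : 'M[R]_d)
    (a : 'rV[R]_d) (k : R) :
  is_trig_mx L -> (forall i, 0 < L i i)%R -> (0 < k)%R ->
  (forall x, 0 <= f x)%R -> (forall x, k * f (x *m L + a) <= g x)%R ->
  (k / \prod_i L i i)%:E * integral_Rd f <= integral_Rd g.
Proof.
move=> /is_trig_mxP trigL L0 k0 f0 fg.
pose row_of (x : nat -> R) := (\row_(i < d) x i)%R.
pose T (x : nat -> R) n : R :=
  oapp (fun j : 'I_d => (row_of x *m L + a)%R ord0 j) 0%R (insub n).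
pose c n : R := oapp (fun j : 'I_d => L j j) 0%R (insub n).
have TE x (j : 'I_d) : T x j = ((row_of x *m L + a) ord0 j)%R by rewrite /T valK.
have row_upd x (j : 'I_d) t :
    row_of (upd_coord x j t) = (row_of x + (t - x j) *: delta_mx ord0 j)%R.
  apply/rowP => i; rewrite !mxE eqxx /= /upd_coord -val_eqE /=.
  by case: eqVneq => [->|]; rewrite ?mulr1 ?mulr0 ?addr0// addrC subrK.
have T_upd x (j i : 'I_d) t : T (upd_coord x j t) i = (T x i + (t - x j) * L j i)%R.
  by rewrite !TE row_upd mulmxDl -scalemxAl -rowE !mxE addrAC.
have T_out x n : (d <= n)%N -> T x n = 0%R.
  by move=> dn; rewrite /T insubF// ltnNge dn.
rewrite /integral_Rd.
(* The base point may be moved to its image under [T]: both vanish from index [d] on. *)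
rewrite (eq_iter_int d _ (fun=> 0%R) (T (fun=> 0%R))); last first.
  by move=> n dn; rewrite T_out.
rewrite (_ : (\prod_i L i i)%R = (\prod_(j < d) c j)%R); last first.
  by apply: eq_bigr => j _; rewrite /c valK.
apply: ge0_le_iter_int_triangular => //.
- move=> j y jd; pose j' := Ordinal jd.
  exists (T y j - y j * L j' j')%R => t.
  have -> : c j = L j' j' by rewrite /c (_ : j = j') // valK.
  by rewrite (T_upd y j' j' t) /=; ring.
- move=> j y t i jd ji; have [id|di] := ltnP i d; last by rewrite !T_out.
  by rewrite (T_upd y (Ordinal jd) (Ordinal id)) trigL// mulr0 addr0.
- by move=> j jd; rewrite /c insubT /=; exact: L0.
- by move=> x; rewrite lee_fin.
move=> x; rewrite -EFinM lee_fin; apply: le_trans (fg _); rewrite le_eqVlt.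
apply/orP; left; apply/eqP; congr (k * f _)%R.
by apply/rowP => i; rewrite [LHS]mxE TE.
Qed.

Lemma le_integral_Rd d (f g : 'rV[R]_d -> R) : (forall x, 0 <= f x)%R ->
  (forall x, f x <= g x)%R -> integral_Rd f <= integral_Rd g.
Proof.
move=> f0 fg.
have := @ge0_le_integral_Rd_triangular d f g 1%:M%R 0%R 1%R.
rewrite big1 => [|i _]; last by rewrite mxE eqxx.
rewrite divr1 mul1e; apply=> [|i||//|x].
- exact: scalar_mx_is_trig.
- by rewrite mxE eqxx.
- exact: ltr01.
by rewrite mul1r mulmx1 addr0.
Qed.

End IntegralRd.

(** * Euclidean geometry, LQ decomposition and a rank-one determinant *)

Section Euclidean.
Context {R : realType}.

Section DotProduct.
Context {d : nat}.
Implicit Types x y z : 'rV[R]_d.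

Lemma dotpE x y : x *m y^T = (dotp x y)%:M.
Proof.
rewrite [LHS]mx11_scalar; congr _%:M; rewrite !mxE.
by apply: eq_bigr => i _; rewrite mxE.
Qed.

Lemma dotpC x y : dotp x y = dotp y x.
Proof. by apply: eq_bigr => i _; rewrite mulrC. Qed.

Lemma dotpDl x y z : dotp (x + y) z = dotp x z + dotp y z.
Proof. by rewrite /dotp -big_split; apply: eq_bigr => i _; rewrite mxE mulrDl. Qed.

Lemma dotpZl (c : R) x y : dotp (c *: x) y = c * dotp x y.
Proof. by rewrite /dotp mulr_sumr; apply: eq_bigr => i _; rewrite mxE mulrA. Qed.

Lemma dotpDr x y z : dotp x (y + z) = dotp x y + dotp x z.
Proof. by rewrite ![dotp x _]dotpC dotpDl. Qed.

Lemma dotpZr (c : R) x y : dotp x (c *: y) = c * dotp x y.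
Proof. by rewrite ![dotp x _]dotpC dotpZl. Qed.

Lemma dotpBl x y z : dotp (x - y) z = dotp x z - dotp y z.
Proof. by rewrite -scaleN1r dotpDl dotpZl mulN1r. Qed.

Lemma dotpBr x y z : dotp x (y - z) = dotp x y - dotp x z.
Proof. by rewrite ![dotp x _]dotpC dotpBl. Qed.

Lemma sqnorm_ge0 x : 0 <= sqnorm x.
Proof. by apply: sumr_ge0 => i _; rewrite -expr2 sqr_ge0. Qed.

Lemma sqnorm_eq0 x : (sqnorm x == 0) = (x == 0).
Proof.
apply/idP/eqP => [|->]; last by rewrite /sqnorm -(scale0r 0) dotpZl mul0r.
rewrite psumr_eq0 => [/allP x0|i _]; last by rewrite -expr2 sqr_ge0.
apply/rowP => i; rewrite mxE; apply/eqP.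
by have := x0 i (mem_index_enum _); rewrite /= mulf_eq0 orbb.
Qed.

Lemma sqr_enorm x : enorm x ^+ 2 = sqnorm x.
Proof. by rewrite sqr_sqrtr ?sqnorm_ge0. Qed.

Lemma enorm_ge0 x : 0 <= enorm x.
Proof. exact: sqrtr_ge0. Qed.

(** Cauchy-Schwarz, by expanding the squared norm of |y|^2 x - <x, y> y. *)
Lemma sqr_dotp_le x y : dotp x y ^+ 2 <= sqnorm x * sqnorm y.
Proof.
have [/eqP|y0] := eqVneq (sqnorm y) 0.
  rewrite sqnorm_eq0 => /eqP ->.
  by rewrite /sqnorm -(scale0r 0) !dotpZr !mul0r mulr0 expr0n.
have yp : 0 < sqnorm y by rewrite lt_def y0 sqnorm_ge0.
have := sqnorm_ge0 (sqnorm y *: x - dotp x y *: y).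
rewrite {1}/sqnorm dotpBl !dotpBr !dotpZl !dotpZr (dotpC y x) -/(sqnorm x) -/(sqnorm y).
rewrite [X in _ <= X -> _](_ : _ =
  sqnorm y * (sqnorm x * sqnorm y - dotp x y ^+ 2)); last by ring.
by rewrite pmulr_rge0// subr_ge0.
Qed.

Lemma dotp_le_enorm x y : dotp x y <= enorm x * enorm y.
Proof.
rewrite -sqrtrM ?sqnorm_ge0//; apply: le_trans (ler_norm _) _.
by rewrite -sqrtr_sqr ler_sqrt ?mulr_ge0 ?sqnorm_ge0// sqr_dotp_le.
Qed.

End DotProduct.

Lemma sqnorm_mulmx_orthogonal d (x : 'rV[R]_d) (Q : 'M[R]_d) :
  Q *m Q^T = 1%:M -> sqnorm (x *m Q) = sqnorm x.
Proof.
move=> QQ; have /(congr1 (fun M : 'M[R]_1 => M ord0 ord0)) := dotpE (x *m Q) (x *m Q).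
rewrite trmx_mul mulmxA -(mulmxA x) QQ mulmx1 dotpE !mxE eqxx !mulr1n.
by rewrite /sqnorm => ->.
Qed.

Lemma orthogonal_transport d (u e : 'rV[R]_d) : sqnorm u = sqnorm e ->
  exists2 Q : 'M[R]_d, Q *m Q^T = 1%:M & u *m Q = e.
Proof.
(* Use the Householder reflection along [u - e]. *)
move=> ue; have [w wE] : exists w, w = u - e by exists (u - e).
have [/eqP|N0] := eqVneq (sqnorm w) 0.
  rewrite sqnorm_eq0 wE subr_eq0 => /eqP ->.
  by exists 1%:M; rewrite ?trmx1 mulmx1.
pose k := 2 / sqnorm w.
have kN : k * sqnorm w = 2 by rewrite mulfVK.
exists (1%:M - k *: (w^T *m w)).
  rewrite (_ : (1%:M - _)^T = 1%:M - k *: (w^T *m w)); last first.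
    by apply/matrixP => i j; rewrite !mxE eq_sym; congr (_ - _ * _);
      apply: eq_bigr => l _; rewrite !mxE mulrC.
  rewrite mulmxBl mul1mx mulmxBr mulmx1 -scalemxAl -scalemxAr.
  rewrite -mulmxA (mulmxA w) dotpE mul_scalar_mx -scalemxAr -/(sqnorm w).
  rewrite (scalerA k (sqnorm w)) kN scaler_nat -scalerMnr mulr2n.
  by rewrite opprB addrK subrK.
rewrite mulmxBr mulmx1 -scalemxAr mulmxA dotpE mul_scalar_mx scalerA.
(* Since |u| = |e|, |w|^2 = 2 <u, w>, so the reflection subtracts exactly [w] from [u]. *)
suff -> : k * dotp u w = 1 by rewrite scale1r wE opprB addrC subrK.
apply: (mulfI (_ : (2 : R) != 0)); first by rewrite pnatr_eq0.
rewrite mulrCA mulr1 -[RHS]kN; congr (_ * _).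
rewrite wE /sqnorm dotpBl !dotpBr (dotpC e u) -/(sqnorm u) -/(sqnorm e) ue; ring.
Qed.

(** An orthogonal [H] turns the first row into (s, 0) with s its norm; the induction then treats the
    lower right block. *)
Lemma exists_lq n (A : 'M[R]_n) : exists2 Q : 'M[R]_n,
  Q *m Q^T = 1%:M & is_trig_mx (A *m Q) /\ forall i, 0 <= (A *m Q) i i.
Proof.
elim: n A => [|n IHn] A.
  exists 1%:M; first by rewrite trmx1 mulmx1.
  by split; [apply/is_trig_mxP|]; case.
pose A' : 'M[R]_(1 + n) := A.
suff: exists2 Q : 'M[R]_(1 + n),
  Q *m Q^T = 1%:M & is_trig_mx (A' *m Q) /\ forall i, 0 <= (A' *m Q) i i by [].
pose u := usubmx A'; pose s := enorm u.
have [|H HH uH] := orthogonal_transport _ u (row_mx s%:M 0 : 'rV_(1 + n)).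
  have /(congr1 (fun M : 'M[R]_1 => M ord0 ord0)) :=
    dotpE (row_mx s%:M 0 : 'rV_(1 + n)) (row_mx s%:M 0).
  rewrite tr_row_mx mul_row_col trmx0 mulmx0 addr0 tr_scalar_mx -scalar_mxM.
  by rewrite !mxE eqxx !mulr1n -expr2 sqr_enorm.
pose B : 'M[R]_(n, 1 + n) := dsubmx A' *m H.
have [Q' QQ' [trigQ diagQ]] := IHn (rsubmx B).
pose Q := block_mx 1%:M 0 0 Q' : 'M[R]_(1 + n).
have AE : A' *m (H *m Q) =
    block_mx s%:M 0 (lsubmx B) (rsubmx B *m Q') :> 'M[R]_(1 + n).
  rewrite mulmxA -{1}(vsubmxK A') mul_col_mx uH -/B -{1}(hsubmxK B).
  rewrite [X in X *m _](_ : _ = block_mx s%:M 0 (lsubmx B) (rsubmx B)) //.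
  by rewrite mulmx_block !mul0mx !mulmx0 !mulmx1 !addr0 !add0r.
exists (H *m Q).
  rewrite trmx_mul mulmxA -(mulmxA H) /Q tr_block_mx mulmx_block.
  rewrite !trmx0 !trmx1 !mul0mx !mulmx0 !mulmx1 !addr0 !add0r QQ'.
  by rewrite -scalar_mx_block mulmx1.
rewrite AE is_trig_block_mx// eqxx trigQ scalar_mx_is_trig; split=> // i.
case: (split_ordP i) => j ->.
  by rewrite block_mxEul (ord1 j) mxE eqxx mulr1n enorm_ge0.
by rewrite block_mxEdr.
Qed.

(** Matrix determinant lemma, from two triangular factorizations of one block matrix. *)
Lemma det_1_add_mulmx n (u v : 'rV[R]_n) :
  \det (1%:M + u^T *m v) = 1 + dotp v u.
Proof.
have E1 : block_mx 1%:M (- v) u^T 1%:M =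
    block_mx 1%:M 0 u^T 1%:M *m block_mx 1%:M (- v) 0 (1%:M + u^T *m v)
    :> 'M[R]_(1 + n).
  rewrite mulmx_block !mul0mx !mulmx0 !mulmx1 !mul1mx !addr0.
  by rewrite mulmxN addrC addrK.
have E2 : block_mx 1%:M (- v) u^T 1%:M =
    block_mx (1%:M + v *m u^T) (- v) 0 1%:M *m block_mx 1%:M 0 u^T 1%:M
    :> 'M[R]_(1 + n).
  by rewrite mulmx_block !mul0mx !mulmx0 !mulmx1 !mul1mx !add0r mulNmx addrK.
have := congr1 determinant E1; rewrite {1}E2.
rewrite !det_mulmx !det_ublock !det_lblock !det1 !mul1r !mulr1 => <-.
by rewrite dotpE det_mx11 !mxE eqxx !mulr1n.
Qed.

End Euclidean.

(** * The height function and consequences of the John condition *)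

Section HeightFunction.
Context {R : realType} {d : nat}.
Implicit Types (x y z : 'rV[R]_d) (f : 'rV[R]_d -> R).

Lemma hbar_ge0 x : 0 <= hbar x.
Proof. by rewrite /hbar; case: ifP => // _; exact: sqrtr_ge0. Qed.

Lemma hbar_le1 x : hbar x <= 1.
Proof.
rewrite /hbar; case: ifP => // _.
by rewrite -[leRHS]sqrtr1 ler_wsqrtr// gerBl sqnorm_ge0.
Qed.

Lemma hbar_eq0 x : 1 <= sqnorm x -> hbar x = 0.
Proof.
rewrite le_eqVlt /hbar => /predU1P[<-|x1]; first by rewrite lexx subrr sqrtr0.
by rewrite leNgt x1.
Qed.

Lemma hbar_mulmx_orthogonal x (Q : 'M[R]_d) :
  Q *m Q^T = 1%:M -> hbar (x *m Q) = hbar x.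
Proof. by move=> QQ; rewrite /hbar sqnorm_mulmx_orthogonal. Qed.

Lemma integral_hbar_gt0 : (0 < integral_Rd (@hbar R d))%E.
Proof.
(* With this [delta], (d + 1) delta^2 = delta / 2 <= 1/2, so on the cube [hbar] is at least sqrt
   (1/2). *)
pose delta : R := (2 * d.+1%:R)^-1.
have delta0 : 0 < delta by rewrite invr_gt0 mulr_gt0.
apply: (@iter_int_gt0 _ _ _ _ delta (Num.sqrt 2^-1)) => [//|||].
- by rewrite sqrtr_gt0 invr_gt0.
- by move=> x; rewrite lee_fin hbar_ge0.
move=> x xdelta; rewrite lee_fin.
set y := \row_(i < d) x i.
have y2 : sqnorm y <= 2^-1.
  apply: (@le_trans _ _ (\sum_(i < d) delta ^+ 2)).
    apply: ler_sum => i _; rewrite !mxE -expr2 -real_normK ?num_real//.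
    by rewrite lerXn2r ?nnegrE ?(ltW delta0)//; exact: xdelta.
  rewrite sumr_const card_ord -[leLHS]mulr_natl.
  apply: (@le_trans _ _ (d.+1%:R * delta ^+ 2)).
    by apply: ler_wpM2r; rewrite ?sqr_ge0// ler_nat.
  rewrite expr2 mulrA.
  have -> : d.+1%:R * delta = 2^-1 by rewrite /delta invfM mulrCA divff ?mulr1 ?pnatr_eq0.
  rewrite ler_piMr// invf_le1 ?mulr_gt0//.
  by rewrite -natrM ler1n.
rewrite /hbar (le_trans y2) ?invf_le1 ?ler1n//.
by rewrite ler_wsqrtr// lerBrDr -lerBrDl (le_trans y2)// lerBrDr; lra.
Qed.

(** The position has integral at least beta / |det A| times that of [hbar], and at most that of
    [hbar] by maximality; the latter is positive and finite, hence cancels. *)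
Lemma John_position_det f (A : 'M[R]_d) (beta : R) (a : 'rV[R]_d) :
  (integral_Rd f < +oo)%E -> is_John_function_hbar f ->
  A \in unitmx -> 0 < beta -> (forall x, beta * hbar (x *m A + a) <= f x) ->
  beta <= `|\det A|.
Proof.
move=> fint [hf John] Aunit beta0 gf.
have [Q QQ [trigL diagL]] := exists_lq _ A.
pose L := A *m Q.
have detQ : `|\det Q| = 1.
  have : \det Q ^+ 2 = 1 by rewrite -(det1 R d) -QQ det_mulmx det_tr expr2.
  by move=> /eqP; rewrite sqrf_eq1 => /orP[] /eqP ->; rewrite ?normrN normr1.
have detL : \prod_i L i i = `|\det A|.
  rewrite -(mulr1 `|\det A|) -[X in _ = _ * X]detQ -normrM -det_mulmx det_trig// ger0_norm//.
  by apply: prodr_ge0 => i _; exact: diagL.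
have detA0 : 0 < `|\det A| by rewrite normr_gt0 -unitfE -unitmxE.
have L0 i : 0 < L i i.
  rewrite lt_def diagL andbT; apply/eqP => Li0; move: detA0.
  by rewrite -detL (bigD1 i)//= Li0 mul0r ltxx.
pose g x := beta * hbar (x *m A + a).
have hL x : beta * hbar (x *m L + a *m Q) <= g x.
  by rewrite mulmxA -mulmxDl hbar_mulmx_orthogonal.
have := ge0_le_integral_Rd_triangular _ _ _ _ _ _ trigL L0 beta0 hbar_ge0 hL.
have gpos : is_position g by exists A, beta, a.
move=> /le_trans /(_ (John _ gpos gf)); rewrite detL.
have : (integral_Rd (@hbar R d) < +oo)%E.
  by apply: le_lt_trans fint; apply: le_integral_Rd => //; exact: hbar_ge0.
have := integral_hbar_gt0.
case: (integral_Rd _) => // I; rewrite lte_fin -EFinM lee_fin => I0 _.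
by rewrite ger_pMl// ler_pdivrMr// mul1r.
Qed.

Lemma log_concave_ge_cone f x0 y (t : R) : (forall x, 0 <= f x) ->
  (forall x, hbar x <= f x) -> log_concave f -> 0 < f x0 -> 0 < t < 1 ->
  hbar y * expR (t * ln (f x0)) <= f ((1 - t) *: y + t *: x0).
Proof.
move=> f0 hf lcf fx0 t01; have /andP[t0 t1] := t01.
apply: le_trans (lcf _ _ _ t01); rewrite {2}/powR gt_eqF//.
rewrite ler_wpM2r ?expR_ge0//.
apply: (@le_trans _ _ (hbar y `^ (1 - t))).
  have := hbar_ge0 y; rewrite le_eqVlt => /predU1P[<-|h0].
    by rewrite powR_ge0.
  by rewrite ger1_powR ?h0 ?hbar_le1// gerBl ltW.
by rewrite ge0_ler_powR ?nnegrE ?hbar_ge0// subr_ge0 ltW.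
Qed.

End HeightFunction.

(** * Upper bounds on the logarithm of f at a point *)

Section PointwiseBound.
Context {R : realType} {d : nat}.
Implicit Types (x y z : 'rV[R]_d).

Lemma ln_ge_1Binv (x : R) : 0 < x -> 1 - x^-1 <= ln x.
Proof.
move=> x0; have := @le_ln1Dx R (x^-1 - 1).
rewrite (addrC 1) subrK lnV// lerNl opprB; apply.
by rewrite ltrBrDr addrC subrr invr_gt0.
Qed.

(** Stands in for letting t tend to 0. If a > b, the choice of [D] gives both t < 1/2 and t |c| < (a
    - b) / 2, a contradiction. *)
Lemma le_of_le_mul_small (a b c : R) :
  (forall t, 0 < t < 2^-1 -> a <= b + t * c) -> a <= b.
Proof.
move=> H; rewrite leNgt; apply/negP => ba.
pose D := a - b + `|c| + 1.
have D0 : 0 < D by rewrite /D; have := normr_ge0 c; lra.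
pose t := (a - b) / (2 * D).
have tE : t * (2 * D) = a - b by rewrite mulfVK// mulf_neq0// gt_eqF.
have t0 : 0 < t by rewrite divr_gt0 ?subr_gt0// mulr_gt0.
have t1 : t < 2^-1.
  by rewrite ltr_pdivrMr ?mulr_gt0// mulrA mulVf ?mul1r// /D; have := normr_ge0 c; lra.
have tc : t * c <= t * `|c| by rewrite ler_wpM2l ?ler_norm// ltW.
have /H : 0 < t < 2^-1 by rewrite t0.
move: tE tc; rewrite /D => tE tc; have := normr_ge0 c.
nra.
Qed.

Variables (f : 'rV[R]_d -> R) (x0 : 'rV[R]_d).
Hypotheses (f0 : forall x, 0 <= f x) (lcf : log_concave f).
Hypothesis fint : (integral_Rd f < +oo)%E.
Hypothesis Jf : is_John_function_hbar f.
Hypothesis fx0 : 0 < f x0.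

Lemma John_ln_le_dim : ln (f x0) <= d%:R.
Proof.
(* The estimate reached below is (1 - t) ln (f x0) <= d. *)
apply: (@le_of_le_mul_small _ _ (ln (f x0))) => t /andP[t0 t12].
have t1 : 0 < 1 - t by lra.
have : expR (t * ln (f x0)) <= `|\det ((1 - t)^-1%:M : 'M[R]_d)|.
  (* The affine map is x |-> (x - t x0) / (1 - t), inverse to the homothety towards [x0]. *)
  apply: (@John_position_det _ _ f _ _ (- (t / (1 - t)) *: x0)) => //.
  - by rewrite unitmxE det_scalar unitfE expf_neq0// invr_eq0 gt_eqF.
  - exact: expR_gt0.
  move=> x; rewrite mulrC.
  set y := x *m _ + _.
  rewrite [in leRHS](_ : x = (1 - t) *: y + t *: x0).
    by apply: log_concave_ge_cone => //; [case: Jf|rewrite t0; lra].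
  rewrite /y mul_mx_scalar scalerDr !scalerA mulfV ?gt_eqF// scale1r -addrA.
  rewrite -scalerDl (_ : _ + t = 0) ?scale0r ?addr0//.
  by field; rewrite gt_eqF.
rewrite det_scalar ger0_norm ?exprn_ge0 ?invr_ge0 ?(ltW t1)//.
move=> H0; have : ln (expR (t * ln (f x0))) <= ln ((1 - t)^-1 ^+ d).
  by rewrite ler_ln ?posrE ?expR_gt0 ?exprn_gt0 ?invr_gt0.
rewrite expRK lnXn ?invr_gt0// lnV ?posrE// -[_ *+ d]mulr_natl => H.
have lnt := ln_ge_1Binv _ t1.
have : t * ln (f x0) <= t * (d%:R / (1 - t)).
  apply: le_trans H _; rewrite mulrCA ler_wpM2l// lerNl (le_trans _ lnt)//.
  by rewrite le_eqVlt; apply/orP; left; apply/eqP; field; rewrite gt_eqF.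
rewrite ler_pM2l// ler_pdivlMr//; lra.
Qed.


(* For [x0 = r *: v], the left-hand side divided by [(1 - t) ^+ 2] is [1 - |y|^2] where
   [z = (1 - t) *: y + t *: x0]: the projective map [u |-> y] preserves the unit ball. *)
Lemma projective_identity (v z : 'rV[R]_d) (tau r q kap : R) :
  sqnorm v = 1 -> q != 0 -> q ^+ 2 = 1 - 2 * tau -> kap = 1 + tau * (r - 1) ->
  kap != 0 ->
  let u := q^-1 *: (z + ((q / kap - 1) * dotp z v) *: v) + (kap^-1 - 1) *: v in
  let t := tau * (1 + dotp u v) in
  (1 - t) ^+ 2 - sqnorm (z - (t * r) *: v) = q ^+ 2 * (1 - sqnorm u).
Proof.
move=> v1 q0 q2 kapE kap0 u t.
pose zeta := dotp z v.
have uE : u = q^-1 *: z + ((kap^-1 - q^-1) * zeta + kap^-1 - 1) *: v.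
  rewrite /u scalerDr scalerA -addrA -scalerDl -/zeta; congr (_ + _ *: _).
  by field; rewrite ?q0 ?kap0.
have uv : dotp u v = (zeta + 1) / kap - 1.
  rewrite uE dotpDl !dotpZl -/(sqnorm v) v1 -/zeta.
  by field; rewrite ?q0 ?kap0.
have normz : sqnorm (z - (t * r) *: v) = sqnorm z - 2 * (t * r) * zeta + (t * r) ^+ 2.
  rewrite {1}/sqnorm dotpBl !dotpBr !dotpZl !dotpZr (dotpC v z).
  rewrite -/(sqnorm z) -/(sqnorm v) v1 -/zeta; ring.
have normu : q ^+ 2 * sqnorm u = sqnorm z - zeta ^+ 2 + q ^+ 2 * dotp u v ^+ 2.
  rewrite uv {1}uE /sqnorm dotpDl !dotpDr !dotpZl !dotpZr (dotpC v z).
  rewrite -/(sqnorm z) -/(sqnorm v) v1 -/zeta.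
  by field; rewrite ?q0 ?kap0.
(* With <z, v> expressed through <u, v>, the terms |z|^2 cancel and a polynomial identity
   remains. *)
have zetaE : zeta = kap * (1 + dotp u v) - 1 by rewrite uv; field.
rewrite mulrBr mulr1 normu normz /t; move: zetaE; set a := dotp u v => ->.
rewrite q2 kapE; ring.
Qed.

Lemma John_ln_decay : d.+1%:R < enorm x0 ->
  enorm x0 - d.+1%:R + 2 * Num.min (ln (f x0) + 1) 0 <= 0.
Proof.
set r := enorm x0; set l := Num.min _ 0 => rd.
have hf : forall x, hbar x <= f x by case: Jf.
have d0 : 0 <= d%:R :> R by [].
have rE : d.+1%:R = d%:R + 1 :> R by rewrite -natr1.
have r0 : 0 < r by lra.
pose v := r^-1 *: x0.
have x0E : x0 = r *: v by rewrite scalerA mulfV ?gt_eqF// scale1r.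
have v1 : sqnorm v = 1.
  by rewrite /sqnorm dotpZl dotpZr -/(sqnorm x0) -sqr_enorm -/r; field; rewrite gt_eqF.
have l0 : l <= 0 by rewrite /l ge_min lexx orbT.
have lL : l <= ln (f x0) + 1 by rewrite /l ge_min lexx.
pose w := r - 1.
(* This constant collects the terms linear in [tau] once denominators are cleared at the end, except
   4 tau l, which is nonpositive, as is the quadratic term 4 tau^2 l w. *)
apply: (@le_of_le_mul_small _ _ (2 * w - 2 * l * w + d%:R * w)) => tau /andP[tau0 tau12].
pose q := Num.sqrt (1 - 2 * tau).
have q2 : q ^+ 2 = 1 - 2 * tau by rewrite sqr_sqrtr//; lra.
have q0 : 0 < q by rewrite sqrtr_gt0; lra.
pose kap := 1 + tau * w.
have w0 : 0 < w by rewrite /w; lra.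
have kap0 : 0 < kap by rewrite addr_gt0// mulr_gt0.
(* [A] scales by 1 / kap along [v] and by 1 / q across; with the translation below it maps onto the
   unit ball the ellipsoid centred at (kap - 1) v, which passes through -v. *)
pose A : 'M[R]_d := q^-1 *: (1%:M + v^T *m ((q / kap - 1) *: v)).
have detA : \det A = q^-1 ^+ d * (q / kap).
  by rewrite detZ det_1_add_mulmx dotpZl -/(sqnorm v) v1; congr (_ * _); ring.
have detA0 : 0 < \det A.
  by rewrite detA mulr_gt0 ?exprn_gt0 ?divr_gt0 ?invr_gt0.
(* The cone bound gives f z >= q hbar(u) exp (t ln (f x0)) / (1 - t). As 1 / (1 - t) >= exp t, the
   exponent becomes t (ln (f x0) + 1) >= t l >= 2 tau l, using l <= 0 and t <= 2 tau. *)
have : q * expR (2 * tau * l) <= `|\det A|.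
  apply: (@John_position_det _ _ f _ _ ((kap^-1 - 1) *: v)) => //.
  - by rewrite unitmxE unitfE gt_eqF.
  - by rewrite mulr_gt0 ?expR_gt0.
  move=> z; set u := z *m A + _.
  have uE : u = q^-1 *: (z + ((q / kap - 1) * dotp z v) *: v) + (kap^-1 - 1) *: v.
    rewrite /u /A -scalemxAr mulmxDr mulmx1 mulmxA dotpE mul_scalar_mx.
    by rewrite scalerA (mulrC (dotp z v)).
  have [u1|u1] := leP 1 (sqnorm u); first by rewrite hbar_eq0// mulr0.
  pose t := tau * (1 + dotp u v).
  have := @projective_identity v z tau r q kap v1 (lt0r_neq0 q0) q2 erefl
    (lt0r_neq0 kap0).
  rewrite /= -uE -/t => tE.
  have /andP[a1 a2] : -1 < dotp u v < 1.
    rewrite -ltr_norml -(@ltr_pXn2r _ 2)// ?nnegrE// real_normK ?num_real//.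
    by rewrite expr1n (le_lt_trans (sqr_dotp_le _ _))// v1 mulr1.
  have t0 : 0 < t by rewrite mulr_gt0//; lra.
  have t2 : t <= 2 * tau by rewrite /t (mulrC 2) ler_pM2l//; lra.
  have t1 : 0 < 1 - t by lra.
  (* The point of the unit ball which the homothety of parameter [t] sends to [z]. *)
  pose y := (1 - t)^-1 *: (z - t *: x0).
  have zE : z = (1 - t) *: y + t *: x0.
    by rewrite scalerA mulfV ?gt_eqF// scale1r subrK.
  have hy : hbar y = q / (1 - t) * hbar u.
    have sE : 1 - sqnorm y = (q / (1 - t)) ^+ 2 * (1 - sqnorm u).
      rewrite exprMn mulrAC -tE /y x0E scalerA.
      by rewrite {1}/sqnorm dotpZl dotpZr -/(sqnorm _); field; rewrite gt_eqF.
    have y1 : sqnorm y <= 1.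
      by rewrite -subr_ge0 sE mulr_ge0 ?sqr_ge0// subr_ge0 ltW.
    rewrite /hbar y1 ltW// sE sqrtrM ?sqr_ge0// sqrtr_sqr ger0_norm//.
    by rewrite divr_ge0 ?ltW.
  rewrite [in leRHS]zE.
  apply: le_trans (@log_concave_ge_cone _ _ f x0 y t f0 hf lcf fx0 _); last first.
    by rewrite t0; lra.
  rewrite hy [leRHS]mulrAC ler_wpM2r ?hbar_ge0// -[leRHS]mulrA ler_pM2l//.
  rewrite [leRHS]mulrC ler_pdivlMr//.
  have e1 : 1 - t <= expR (- t) by exact: expR_ge1Dx.
  apply: (@le_trans _ _ (expR (2 * tau * l) * expR (- t))).
    by rewrite ler_wpM2l ?expR_ge0.
  rewrite -expRD ler_expR.
  have : t * l <= t * (ln (f x0) + 1) by rewrite ler_pM2l.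
  have : 2 * tau * l <= t * l by rewrite ler_wnM2r.
  by rewrite mulrDr mulr1; lra.
rewrite (gtr0_norm detA0) detA => H0.
have : ln (q * expR (2 * tau * l)) <= ln (q^-1 ^+ d * (q / kap)).
  by rewrite ler_ln ?posrE ?mulr_gt0 ?expR_gt0 ?exprn_gt0 ?divr_gt0 ?invr_gt0.
rewrite !lnM ?posrE ?expR_gt0 ?exprn_gt0 ?mulr_gt0 ?invr_gt0// lnXn ?invr_gt0//.
rewrite !lnV ?posrE// expRK -[_ *+ d]mulr_natl => H.
have lnkap := ln_ge_1Binv _ kap0.
have lnq : 2 * ln q >= 1 - (1 - 2 * tau)^-1.
  have := ln_ge_1Binv (q ^+ 2); rewrite lnXn// q2 -[ln q *+ 2]mulr_natl; apply; lra.
have B : 2 * tau * l + (1 - kap^-1) <= d%:R * (tau / (1 - 2 * tau)).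
  have -> : tau / (1 - 2 * tau) = - (1 - (1 - 2 * tau)^-1) / 2.
    by field; apply/eqP; lra.
  have : d%:R * (1 - (1 - 2 * tau)^-1) <= d%:R * (2 * ln q) by rewrite ler_wpM2l.
  lra.
(* [B] divided by [tau]. *)
have C : 2 * l + w / kap <= d%:R / (1 - 2 * tau).
  rewrite -(ler_pM2l tau0); move: B.
  have -> : 1 - kap^-1 = tau * (w / kap) by rewrite /kap; field; rewrite -/kap gt_eqF.
  lra.
have p0 : 0 < 1 - 2 * tau by lra.
move: C; rewrite ler_pdivlMr// -(ler_pM2r kap0).
have -> : (2 * l + w / kap) * (1 - 2 * tau) * kap = (2 * l * kap + w) * (1 - 2 * tau).
  by field; rewrite gt_eqF.
rewrite /kap rE => C.
have lw : l * w <= 0 by rewrite mulr_le0_ge0// ltW.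
have := mulr_le0_ge0 lw (mulr_ge0 (ltW tau0) (ltW tau0)).
have -> : r = w + 1 by rewrite /w; ring.
nra.
Qed.

End PointwiseBound.

(** * The lower bound on the polar function *)

Theorem theorem5p1 (R : realType) (d : nat) (f : 'rV[R]_d -> R) :
  proper_log_concave f ->
  is_John_function_hbar f ->
  forall p : 'rV[R]_d,
    ((expR (- (d.+1)%:R) * chi_ball (d.+1)%:R^-1 p)%:E <= polar f p)%E.
Proof.
move=> [f0 _ lcf /andP[_ fint]] Jf p.
apply: le_ereal_inf_tmp => _ [x /= fx0 <-]; rewrite lee_fin.
rewrite /chi_ball; case: ifP => [pn|_]; last first.
  by rewrite mulr0 divr_ge0 ?expR_ge0// ltW.
have nE : d.+1%:R = d%:R + 1 :> R by rewrite -natr1.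
have n0 : 0 < d.+1%:R :> R by [].
rewrite mulr1 ler_pdivlMr// -[f x]lnK ?posrE// -expRD ler_expR.
have px : dotp p x <= enorm x / d.+1%:R.
  apply: le_trans (dotp_le_enorm _ _) _.
  by rewrite mulrC ler_wpM2l ?enorm_ge0.
rewrite -lerBrDl opprK.
set e := enorm x / d.+1%:R in px *.
suff : ln (f x) + e <= d.+1%:R.
  by rewrite -lerBrDr => /le_trans; apply; rewrite addrC lerD2r lerN2.
have Ld := John_ln_le_dim f x f0 lcf fint Jf fx0.
have [xd|xd] := leP (enorm x) d.+1%:R.
  have : e <= 1 by rewrite ler_pdivrMr// mul1r.
  lra.
have := John_ln_decay f x f0 lcf fint Jf fx0 xd.
(* A minimum equal to 0 would contradict |x| > d + 1; otherwise ln (f x) <= (d + 1 - |x|) / 2 -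
   1. *)
rewrite minEle; case: ifP => [_|_]; last by lra.
(* In dimension 0 the norm of [x] is 0, so here d >= 1 and e <= |x| / 2 is absorbed by the decay. *)
have d2 : 2 <= d.+1%:R :> R.
  rewrite ler_nat ltnS lt0n; apply/eqP => d0; move: xd.
  suff -> : enorm x = 0 by rewrite ltNge ler0n.
  by apply/eqP; rewrite sqrtr_eq0 /sqnorm /dotp; subst d; rewrite big_ord0.
have : e <= enorm x / 2.
  by rewrite ler_wpM2l ?enorm_ge0// lef_pV2 ?posrE.
lra.
Qed.
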